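(* Let $n\ge1$ and let $G=(V,E)$ be the graph with vertex set $V=\{0,1,\dots,n\}$ and edge set $E=\{\{i,i+1\}:i=0,\dots,n-1\}$. Let $\pi,\nu$ be positive measures on $V,E$ with $\pi(V)=1$. Then $$\lambda^G_{\pi,\nu}\ge\max_{0\le i\le n}\left\{\left(\sum_{j=0}^{i-1}\frac{\pi([0,j])}{\nu(j,j+1)}\right)^{-1}\wedge\left(\sum_{j=i+1}^{n}\frac{\pi([j,n])}{\nu(j-1,j)}\right)^{-1}\right\},$$ where $a\wedge b=\min\{a,b\}$.
   Context: For $A\subset V$, $\pi(A)=\sum_{i\in A}\pi(i)$; $[k,l]$ denotes $\{k,k+1,\dots,l\}$; $\nu(i,i+1)$ is the weight of the edge $\{i,i+1\}$. For $f:V\to\mathbb{R}$ put $\pi(f)=\sum_i f(i)\pi(i)$, $\mathcal{E}_\nu(f,f)=\sum_{i=0}^{n-1}[f(i)-f(i+1)]^2\nu(i,i+1)$, $\mathrm{Var}_\pi(f)=\pi(f^2)-\pi(f)^2$. The spectral gap is $\lambda^G_{\pi,\nu}=\min\{\mathcal{E}_\nu(f,f)/\mathrm{Var}_\pi(f): f\text{ non-constant}\}$. The inverse of an empty sum (cases $i=0$ and $i=n$) is read as $+\infty$. *)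

(* Defs.v *)
From mathcomp Require Import all_boot all_order all_algebra.
From mathcomp Require Import all_classical all_reals all_analysis.
From mathcomp Require Import ring.

Set Implicit Arguments.
Unset Strict Implicit.
Unset Printing Implicit Defensive.

Import Order.TTheory GRing.Theory Num.Theory numFieldNormedType.Exports.

Local Open Scope classical_set_scope.
Local Open Scope ring_scope.

(* The path 0 - 1 - ... - n: a vertex is i : 'I_n.+1, and e : 'I_n stands for
   the edge {e, e+1}, whose endpoints as vertices are the two maps below. *)
Definition lo {n : nat} (e : 'I_n) : 'I_n.+1 := widen_ord (leqnSn n) e.
Definition hi {n : nat} (e : 'I_n) : 'I_n.+1 := lift ord0 e.

Section Defs.
Context {R : realType} {n : nat}.
Implicit Types (pi f : 'I_n.+1 -> R) (nu : 'I_n -> R).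

Definition mass pi (k l : nat) : R := \sum_(i < n.+1 | (k <= i <= l)%N) pi i.

Definition mean pi f : R := \sum_(i < n.+1) f i * pi i.

Definition variance pi f : R := mean pi (fun i => f i ^+ 2) - mean pi f ^+ 2.

Definition dirichlet nu f : R :=
  \sum_(e < n) (f (lo e) - f (hi e)) ^+ 2 * nu e.

Definition nonconstant f : Prop := exists i j, f i != f j.

Definition rayleigh pi nu : set R :=
  [set dirichlet nu f / variance pi f | f in nonconstant].

(* A minimum when 0 < n and pi is a positive probability measure, see
   [spectral_gap_min]. *)
Definition spectral_gap pi nu : R := inf (rayleigh pi nu).

(* Inverses are taken in \bar R, where 0^-1 = +oo: this is the convention for
   the empty sums [left_sum _ _ 0] and [right_sum _ _ n]. *)
Definition left_sum pi nu (i : nat) : R :=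
  \sum_(e < n | (e < i)%N) mass pi 0 e / nu e.

(* Reindexed by j = e + 1: the summand j of the sum over i < j <= n uses the
   edge {j-1, j}, which is e = j - 1. *)
Definition right_sum pi nu (i : nat) : R :=
  \sum_(e < n | (i <= e)%N) mass pi e.+1 n / nu e.

End Defs.

Section SpectralGapIsMin.
Context {R : realType} {n : nat}.
Implicit Types (pi f : 'I_n.+1 -> R) (nu : 'I_n -> R).

Lemma variance_center pi f : \sum_(i < n.+1) pi i = 1 ->
  variance pi f = \sum_(i < n.+1) (f i - mean pi f) ^+ 2 * pi i.
Proof.
move=> pi1; rewrite /variance {1}/mean; set m := mean pi f.
rewrite [RHS](eq_bigr (fun i => f i ^+ 2 * pi i - 2 * m * (f i * pi i)
                            + m ^+ 2 * pi i)); last by move=> i _; ring.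
by rewrite big_split sumrB /= -!mulr_sumr pi1 -/(mean pi f) -/m; ring.
Qed.

Lemma variance_gt0 pi f : (forall i, 0 < pi i) -> \sum_(i < n.+1) pi i = 1 ->
  nonconstant f -> 0 < variance pi f.
Proof.
move=> pi_gt0 pi1 [i [j fij]]; rewrite variance_center//.
have h k : true -> 0 <= (f k - mean pi f) ^+ 2 * pi k.
  by move=> _; rewrite mulr_ge0 ?sqr_ge0// ltW.
rewrite lt_neqAle sumr_ge0// andbT eq_sym; apply: contra fij => /eqP e0.
have e k : f k = mean pi f.
  have /eqP := psumr_eq0P h e0 (i := k) isT.
  by rewrite mulf_eq0 (gt_eqF (pi_gt0 k)) orbF sqrf_eq0 subr_eq0 => /eqP.
by rewrite !e.
Qed.

Let affine a b f : 'I_n.+1 -> R := fun i => a * (f i - b).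

Lemma variance_affine pi a b f : \sum_(i < n.+1) pi i = 1 ->
  variance pi (affine a b f) = a ^+ 2 * variance pi f.
Proof.
move=> pi1; rewrite !variance_center// mulr_sumr.
have -> : mean pi (affine a b f) = a * (mean pi f - b).
  rewrite /mean /affine mulrBr mulr_sumr -[a * b]mulr1 -pi1 mulr_sumr -sumrB.
  by apply: eq_bigr => i _; rewrite mulrBr mulrBl !mulrA.
by apply: eq_bigr => i _; rewrite /affine; ring.
Qed.

Lemma dirichlet_affine nu a b f :
  dirichlet nu (affine a b f) = a ^+ 2 * dirichlet nu f.
Proof.
rewrite /dirichlet mulr_sumr; apply: eq_bigr => i _; rewrite /affine.
ring.
Qed.

Lemma continuous_sumr (T : topologicalType) (m : nat) (F : 'I_m -> T -> R) :
  (forall i, continuous (F i)) -> continuous (fun x => \sum_(i < m) F i x).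
Proof.
move=> cF x; rewrite /continuous_at; elim: (index_enum _) => [|i s IH].
  rewrite big_nil [X in X @ _ --> _](_ : _ = cst 0); first exact: cvg_cst.
  by apply/funext => y; rewrite big_nil.
rewrite big_cons [X in X @ _ --> _](_ : _ =
    F i \+ (fun y => \sum_(j <- s) F j y)); first by apply: cvgD => //; exact: cF.
by apply/funext => y; rewrite big_cons.
Qed.

Lemma spectral_gap_min pi nu :
  (0 < n)%N -> (forall i, 0 < pi i) -> \sum_(i < n.+1) pi i = 1 ->
  rayleigh pi nu (spectral_gap pi nu) /\
  lbound (rayleigh pi nu) (spectral_gap pi nu).
Proof.
move=> n_gt0 pi_gt0 pi1.
suff [c Rc cmin] : exists2 c, rayleigh pi nu c & lbound (rayleigh pi nu) c.
  suff -> : spectral_gap pi nu = c by [].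
  apply/le_anti/andP; split; first by apply: ge_inf => //; exists c.
  by apply: lb_le_inf => //; exists c.
pose N (v : 'rV[R]_n.+1) : R := \sum_(i < n.+1) `|v ord0 i|.
pose A (i : 'I_n.+1) : set R :=
  if i == ord0 then [set 0] else `[- 1, 1]%classic.
pose K := [set v : 'rV[R]_n.+1 | forall i, A i (v ord0 i)] `&` (N @^-1` [set 1]).
have coordc i (v : 'rV[R]_n.+1) : w ord0 i @[w --> v] --> v ord0 i.
  exact: coord_continuous.
have Nc : continuous N.
  apply: continuous_sumr => i v; apply: (cvg_norm (coordc i v)).
have KP v : K v -> nonconstant (v ord0).
  case=> /(_ ord0) /= + Nv; rewrite /A eqxx => /= v0.
  have [//|/forallNP h] := pselect (nonconstant (v ord0)); exfalso.
  have vz i : v ord0 i = 0.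
    have /forallNP/(_ ord0) := h i; rewrite v0 => /negP.
    by rewrite negbK => /eqP.
  move: Nv; rewrite /= /N big1 => [/eqP|i _]; last by rewrite vz normr0.
  by rewrite eq_sym oner_eq0.
have PK f : nonconstant f -> exists2 v, K v &
    dirichlet nu f / variance pi f =
    dirichlet nu (v ord0) / variance pi (v ord0).
  move=> nf; pose s := \sum_(i < n.+1) `|f i - f ord0|.
  have s_gt0 : 0 < s.
    rewrite lt_neqAle sumr_ge0// andbT eq_sym; apply/eqP => s0.
    have e k : f k = f ord0.
      have h (i : 'I_n.+1) : true -> 0 <= `|f i - f ord0| by [].
      by have /eqP := psumr_eq0P h s0 (i := k) isT; rewrite normr_eq0 subr_eq0 => /eqP.
    by case: nf => i [j]; rewrite !e eqxx.
  exists (\row_i affine s^-1 (f ord0) f i).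
    split=> [i|].
      rewrite mxE /A; case: eqP => [->|_] /=.
        by rewrite /affine subrr mulr0.
      rewrite in_itv /= -ler_norml normrM gtr0_norm ?invr_gt0//.
      rewrite ler_pdivrMl// mulr1 /s (bigD1 i)//= lerDl; exact: sumr_ge0.
    rewrite /= /N; under eq_bigr do
      rewrite mxE normrM gtr0_norm ?invr_gt0//.
    by rewrite -mulr_sumr mulVf// gt_eqF.
  have -> : (\row_i affine s^-1 (f ord0) f i) ord0 = affine s^-1 (f ord0) f.
    by apply/funext => i; rewrite mxE.
  rewrite dirichlet_affine variance_affine// -mulf_div divff ?mul1r//.
  by rewrite expf_neq0// invr_neq0// gt_eqF.
have K0 : K !=set0.
  have [|v Kv _] := PK (fun i => (i == ord0)%:R); last by exists v.
  by exists ord0, ord_max; rewrite eqxx -val_eqE /= gtn_eqF// oner_eq0.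
have Kc : compact K.
  apply: compact_closedI.
    apply: rV_compact => i; rewrite /A; case: ifP => _; first exact: compact_set1.
    exact: segment_compact.
  by apply: preimage_closed; [move=> ? _; exact: Nc|exact: closed_eq].
have Qc : {within K, continuous
    (fun v : 'rV[R]_n.+1 => dirichlet nu (v ord0) / variance pi (v ord0))}.
  apply: continuous_in_subspaceT => v; rewrite inE => /KP nv.
  have Mc (F : 'I_n.+1 -> 'rV[R]_n.+1 -> R) : (forall i, continuous (F i)) ->
      continuous (fun v => mean pi (F ^~ v)).
    by move=> Fc; apply: continuous_sumr => i w; apply: (cvgM (Fc i w) (cvg_cst (pi i))).
  have sqc (F : 'rV[R]_n.+1 -> R) : continuous F ->
      continuous (fun v => F v ^+ 2).
    by move=> Fc w; apply: (cvgM (Fc w) (Fc w)).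
  have dc : continuous (fun v : 'rV[R]_n.+1 => dirichlet nu (v ord0)).
    apply: continuous_sumr => e w.
    apply: (cvgM (sqc (fun v => v ord0 (lo e) - v ord0 (hi e)) _ w)
                 (cvg_cst (nu e))).
    by move=> u; apply: (cvgB (coordc _ _) (coordc _ _)).
  have vc : continuous (fun v : 'rV[R]_n.+1 => variance pi (v ord0)).
    move=> w; apply: (cvgB (Mc (fun i v => v ord0 i ^+ 2) _ w)).
      by move=> i; apply: sqc => u; exact: (coordc i u).
    apply: (sqc (fun v => mean pi (v ord0))).
    by apply: (Mc (fun i v => v ord0 i)) => i u; exact: (coordc i u).
  by apply: (cvgM (dc v)); apply: (cvgV _ (vc v)); rewrite gt_eqF// variance_gt0.
have [v /set_mem Kv vmin] := compact_EVT_min K0 Kc Qc.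
exists (dirichlet nu (v ord0) / variance pi (v ord0)).
  by exists (v ord0) => //; exact: KP.
by move=> _ [f /PK[w Kw ->] <-]; apply: vmin; exact/mem_set.
Qed.

End SpectralGapIsMin.

(* Main.v *)
Require Import Defs.
From mathcomp Require Import all_boot all_order all_algebra.
From mathcomp Require Import all_classical all_reals all_analysis.
From mathcomp Require Import ring.

Set Implicit Arguments.
Unset Strict Implicit.
Unset Printing Implicit Defensive.

Import Order.TTheory GRing.Theory Num.Theory.

Local Open Scope ring_scope.

(** Fix a vertex i and a function f.  The variance of f is at most its second
    moment about f i ([variance_le_moment]).  For a vertex k, the difference
    f k - f i telescopes along the path from k to i, so Cauchy-Schwarz bounds
    its square by the resistance of that path, the sum of the 1 / nu e over its
    edges, times the Dirichlet energy carried by the path ([sqr_diff_le]).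
    Enlarging this energy to that of the whole side of i containing k, and
    averaging over the vertices k of that side, leaves the pi-average of the
    resistances.  An edge e counts there once for every vertex that it
    separates from i, so this average is [left_sum] on the left and
    [right_sum] on the right.  Adding both sides,

      variance f <= left_sum i * (energy left of i)
                    + right_sum i * (energy right of i)
                 <= max (left_sum i, right_sum i) * (energy of f),

    a Poincare inequality ([poincare]) whose constant is the inverse of the
    i-th term of the maximum in the theorem. *)

(** The difference of the two sides, times s = \sum 1 / w i, is the sum of the
    nonnegative terms w i * (s * a i - t / w i) ^+ 2, where t = \sum a i. *)
Lemma weighted_cauchy_schwarz (R : realFieldType) (I : finType) (P : pred I)
    (w a : I -> R) : (forall i, P i -> 0 < w i) ->
  (\sum_(i | P i) a i) ^+ 2 <=
  (\sum_(i | P i) (w i)^-1) * (\sum_(i | P i) a i ^+ 2 * w i).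
Proof.
move=> w_gt0; set t := \sum_(i | P i) a i.
set s := \sum_(i | P i) (w i)^-1; set q := \sum_(i | P i) _.
have wV_ge0 i : P i -> 0 <= (w i)^-1 by move=> /w_gt0 wi; rewrite invr_ge0 ltW.
have [s0|s_neq0] := eqVneq s 0.
  (* every term 1 / w i is positive, so the index set is empty *)
  have P0 i : P i = false.
    apply/negP => Pi; have /eqP := psumr_eq0P wV_ge0 s0 Pi.
    by rewrite invr_eq0 gt_eqF // w_gt0.
  by rewrite s0 mul0r /t big_pred0 // expr0n.
have s_gt0 : 0 < s by rewrite lt_neqAle eq_sym s_neq0 sumr_ge0.
rewrite -subr_ge0 -(pmulr_rge0 _ s_gt0).
have -> : s * (s * q - t ^+ 2) =
    \sum_(i | P i) w i * (s * a i - t / w i) ^+ 2.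
  rewrite (eq_bigr (fun i => s ^+ 2 * (a i ^+ 2 * w i) - 2 * s * t * a i
                             + t ^+ 2 * (w i)^-1)).
    by rewrite big_split sumrB /= -!mulr_sumr -/t -/s -/q; ring.
  by move=> i /w_gt0 wi; field; rewrite gt_eqF.
by apply: sumr_ge0 => i /w_gt0 wi; rewrite mulr_ge0 ?sqr_ge0 // ltW.
Qed.

Section Path.
Context {R : realType} {n : nat}.
Implicit Types (pi f : 'I_n.+1 -> R) (nu : 'I_n -> R) (i k l : 'I_n.+1).

Let energy nu f (e : 'I_n) : R := (f (lo e) - f (hi e)) ^+ 2 * nu e.

Lemma sum_edge_diff f k l : (k <= l)%N ->
  \sum_(e < n | (k <= e < l)%N) (f (hi e) - f (lo e)) = f l - f k.
Proof.
move=> kl; pose g (m : nat) := f (inord m).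
have gE (j : 'I_n.+1) : g j = f j by rewrite /g inord_val.
have ln : (l <= n)%N by rewrite -ltnS.
rewrite -!gE -(telescope_sumr g kl).
rewrite (big_nat_widen k l n) // big_geq_mkord /=.
apply: eq_big => [e|e _]; first by rewrite andbC.
by rewrite -!gE.
Qed.

Lemma sqr_diff_le nu f k l : (forall e, 0 < nu e) -> (k <= l)%N ->
  (f l - f k) ^+ 2 <= (\sum_(e < n | (k <= e < l)%N) (nu e)^-1) *
                      (\sum_(e < n | (k <= e < l)%N) energy nu f e).
Proof.
move=> nu_gt0 kl; rewrite -(sum_edge_diff f kl).
apply: le_trans (weighted_cauchy_schwarz _ (w := nu) _) _ => //.
rewrite ler_wpM2l ?sumr_ge0 // => [e _|]; first by rewrite invr_ge0 ltW.
by apply: ler_sum => e _; rewrite /energy -sqrrN opprB.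
Qed.

Lemma sum_energy_subset nu f (P Q : pred 'I_n) : (forall e, 0 < nu e) ->
  (forall e, P e -> Q e) ->
  \sum_(e < n | P e) energy nu f e <= \sum_(e < n | Q e) energy nu f e.
Proof.
move=> nu_gt0 PQ; rewrite [leLHS]big_mkcond [leRHS]big_mkcond.
apply: ler_sum => e _; have e_ge0 : 0 <= energy nu f e.
  by rewrite mulr_ge0 ?sqr_ge0 // ltW.
by case: ifP => [/PQ ->|] //; case: ifP.
Qed.

(** An edge e < i lies on the path from k to i for exactly the vertices
    k <= e, whence the factor [mass pi 0 e] once the sums are exchanged. *)
Lemma left_moment_le pi nu f i :
  (forall k, 0 < pi k) -> (forall e, 0 < nu e) ->
  \sum_(k < n.+1 | (k <= i)%N) (f k - f i) ^+ 2 * pi k <=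
  left_sum pi nu i * \sum_(e < n | (e < i)%N) energy nu f e.
Proof.
move=> pi_gt0 nu_gt0.
have -> : left_sum pi nu i = \sum_(k < n.+1 | (k <= i)%N)
    (\sum_(e < n | (k <= e < i)%N) (nu e)^-1) * pi k.
  under [RHS]eq_bigr do rewrite mulr_suml.
  rewrite (exchange_big_dep (fun e : 'I_n => (e < i)%N)) /=; last first.
    by move=> k e _ /andP[].
  apply: eq_bigr => e ei; rewrite /mass mulr_suml; apply: eq_big => [k|k _].
    rewrite leq0n ei andbT /=; apply/idP/andP => [ke|[]//].
    by split=> //; apply: leq_trans ke (ltnW ei).
  by rewrite mulrC.
rewrite mulr_suml; apply: ler_sum => k ki; rewrite [leRHS]mulrAC ler_wpM2r ?(ltW (pi_gt0 k)) //.
rewrite -sqrrN opprB (le_trans (sqr_diff_le f nu_gt0 ki)) //.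
rewrite ler_wpM2l ?sumr_ge0 // => [e _|]; first by rewrite invr_ge0 ltW.
by apply: sum_energy_subset => // e /andP[].
Qed.

Lemma right_moment_le pi nu f i :
  (forall k, 0 < pi k) -> (forall e, 0 < nu e) ->
  \sum_(k < n.+1 | (i < k)%N) (f k - f i) ^+ 2 * pi k <=
  right_sum pi nu i * \sum_(e < n | (i <= e)%N) energy nu f e.
Proof.
move=> pi_gt0 nu_gt0.
have -> : right_sum pi nu i = \sum_(k < n.+1 | (i < k)%N)
    (\sum_(e < n | (i <= e < k)%N) (nu e)^-1) * pi k.
  under [RHS]eq_bigr do rewrite mulr_suml.
  rewrite (exchange_big_dep (fun e : 'I_n => (i <= e)%N)) /=; last first.
    by move=> k e _ /andP[].
  apply: eq_bigr => e ie; rewrite /mass mulr_suml; apply: eq_big => [k|k _].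
    rewrite -[(k <= n)%N]ltnS ltn_ord andbT ie /=; apply/idP/andP => [ek|[]//].
    by split=> //; apply: leq_ltn_trans ie ek.
  by rewrite mulrC.
rewrite mulr_suml; apply: ler_sum => k ik; rewrite [leRHS]mulrAC ler_wpM2r ?(ltW (pi_gt0 k)) //.
rewrite (le_trans (sqr_diff_le f nu_gt0 (ltnW ik))) //.
rewrite ler_wpM2l ?sumr_ge0 // => [e _|]; first by rewrite invr_ge0 ltW.
by apply: sum_energy_subset => // e /andP[].
Qed.

Lemma variance_le_moment pi f (c : R) : \sum_(k < n.+1) pi k = 1 ->
  Defs.variance pi f <= \sum_(k < n.+1) (f k - c) ^+ 2 * pi k.
Proof.
move=> pi1.
have := variance_affine 1 c f pi1; rewrite expr1n mul1r => <-.
rewrite /Defs.variance {1}/mean lerBlDr; under eq_bigr do rewrite mul1r.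
by rewrite lerDl sqr_ge0.
Qed.

Lemma poincare pi nu f i : (forall k, 0 < pi k) -> (forall e, 0 < nu e) ->
  \sum_(k < n.+1) pi k = 1 ->
  Defs.variance pi f <=
  Num.max (left_sum pi nu i) (right_sum pi nu i) * dirichlet nu f.
Proof.
move=> pi_gt0 nu_gt0 pi1; apply: le_trans (variance_le_moment f (f i) pi1) _.
have energy_ge0 e : 0 <= energy nu f e by rewrite mulr_ge0 ?sqr_ge0 // ltW.
rewrite (bigID (fun k : 'I_n.+1 => (k <= i)%N)) /= /dirichlet.
rewrite [in leRHS](bigID (fun e : 'I_n => (e < i)%N)) /= mulrDr.
under [X in _ + X <= _]eq_bigl do rewrite -ltnNge.
under [X in _ <= _ + _ * X]eq_bigl do rewrite -leqNgt.
apply: lerD.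
  apply: le_trans (left_moment_le _ _ pi_gt0 nu_gt0) _.
  by rewrite ler_wpM2r ?sumr_ge0 // le_max lexx.
apply: le_trans (right_moment_le _ _ pi_gt0 nu_gt0) _.
by rewrite ler_wpM2r ?sumr_ge0 // le_max lexx orbT.
Qed.

End Path.

Theorem theorem6p1 (R : realType) (n : nat)
    (pi : 'I_n.+1 -> R) (nu : 'I_n -> R) (n_gt0 : (0 < n)%N)
    (pi_gt0 : forall i, 0 < pi i) (nu_gt0 : forall e, 0 < nu e)
    (pi1 : \sum_(i < n.+1) pi i = 1) :
  (\big[maxe/-oo]_(i < n.+1)
     mine ((left_sum pi nu i)%:E^-1) ((right_sum pi nu i)%:E^-1)
   <= (spectral_gap pi nu)%:E)%E.
Proof.
have [[f f_nc gapE] _] := spectral_gap_min nu n_gt0 pi_gt0 pi1.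
have var_gt0 := variance_gt0 pi_gt0 pi1 f_nc.
have dir_ge0 : 0 <= dirichlet nu f.
  by apply: sumr_ge0 => e _; rewrite mulr_ge0 ?sqr_ge0 // ltW.
apply/bigmax_leP; split=> [|i _]; first exact: leNye.
have := poincare f i pi_gt0 nu_gt0 pi1; set M := Num.max _ _ => var_le.
(* M cannot vanish because f has positive variance, so M^-1 is a genuine real
   inverse and not the convention +oo *)
have M_gt0 : 0 < M.
  rewrite ltNge; apply/negP => M_le0; have := lt_le_trans var_gt0 var_le.
  by rewrite ltNge mulr_le0_ge0.
apply: (@le_trans _ _ (M^-1)%:E); last first.
  by rewrite -gapE lee_fin ler_pdivlMr // mulrC ler_pdivrMr // mulrC.
have -> : (M^-1)%:E = (M%:E^-1)%E by rewrite inver gt_eqF.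
rewrite ge_min /M; case: (leP (left_sum pi nu i) (right_sum pi nu i)) => _.
  by rewrite lexx orbT.
by rewrite lexx.
Qed.
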